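(* Let $f\colon\{-1,1\}^n\to\{-1,1\}$ be a Boolean function. Then: (i) for every $\varepsilon$ with $0\le\varepsilon<1$, $\ \mathbb{H}_\infty(\hat f^2)\le 2\cdot\log_2\!\left(\|\hat f\|_{1,\varepsilon}/(1-\varepsilon)\right)$; (ii) $\mathbb{H}_\infty(\hat f^2)\le 2\cdot \mathsf{C}^{\oplus}_{\min}(f)$; (iii) $\mathbb{H}_\infty(\hat f^2)\le 2(1+\log_2 3)\cdot R_2^{\oplus}(f)$.
   Context: All logarithms are base 2. For $g\colon\{-1,1\}^n\to\mathbb{R}$ and $S\subseteq[n]$, $\hat g(S)=\mathbb{E}_x[g(x)\prod_{i\in S}x_i]$ with $x$ uniform in $\{-1,1\}^n$. The Fourier min-entropy of Boolean $f$ is $\mathbb{H}_\infty(\hat f^2)=\min_{S:\hat f(S)\ne0}\log\frac{1}{\hat f(S)^2}$. Approximate spectral norm: $\|\hat f\|_{1,\varepsilon}=\min\{\sum_S|\hat p(S)| : p\colon\{-1,1\}^n\to\mathbb{R},\ |p(x)-f(x)|\le\varepsilon\ \text{for every }x\in\{-1,1\}^n\}$. Minimum parity-certificate complexity: an affine subspace of $\{-1,1\}^n$ of co-dimension $k$ is a set $\{x:\prod_{i\in S_j}x_i=b_j,\ j=1,\dots,k\}$ with $b_j\in\{-1,1\}$ and $S_1,\dots,S_k\subseteq[n]$ having $\mathbb{F}_2$-linearly independent indicator vectors. $\mathsf{C}^\oplus_{\min}(f)$ is the minimum co-dimension of an affine subspace of $\{-1,1\}^n$ on which $f$ is constant. Randomized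 parity-decision tree complexity: a deterministic parity-decision tree is a rooted binary tree whose internal nodes are labelled by subsets $S\subseteq[n]$ and whose leaves are labelled by values in $\{-1,1\}$; on input $x$, at a node labelled $S$ it evaluates $\prod_{i\in S}x_i$ and continues in the corresponding subtree, outputting the label of the leaf reached. A randomized parity-decision tree is a probability distribution $\mu$ over deterministic parity-decision trees, and its complexity is the largest depth of a tree with non-zero probability under $\mu$. It computes $f$ with bounded error if for every $x$, a tree drawn from $\mu$ outputs $f(x)$ on input $x$ with probability at least $2/3$. $R_2^\oplus(f)$ is the minimum complexity of a randomized parity-decision tree computing $f$ with bounded error. *)

(* Defs.v *)
From HB Require Import structures.
From mathcomp Require Import all_boot all_order all_algebra.
From mathcomp Require Import all_classical all_reals all_analysis.

Set Implicit Arguments.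
Unset Strict Implicit.
Unset Printing Implicit Defensive.

Import Order.TTheory GRing.Theory Num.Theory.
Import numFieldNormedType.Exports.

Local Open Scope classical_set_scope.
Local Open Scope ring_scope.

(* Signs are encoded as booleans: b stands for (-1)^b, that is false is 1
   and true is -1.  So [cube n] is {-1,1}^n, a Boolean function
   {-1,1}^n -> {-1,1} has type [cube n -> bool], and [pm R f] is f seen as a
   real-valued function. *)
Definition cube (n : nat) : finType := {ffun 'I_n -> bool}.

Definition pm (R : realType) (n : nat) (f : cube n -> bool) : cube n -> R :=
  fun x => (-1) ^+ f x.

Definition chi (R : realType) (n : nat) (S : {set 'I_n}) (x : cube n) : R :=
  \prod_(i in S) (-1) ^+ x i.

(* The same product of signs, as a sign; see [chi_parity]. *)
Definition parity (n : nat) (S : {set 'I_n}) (x : cube n) : bool :=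
  \big[addb/false]_(i in S) x i.

Lemma chi_parity (R : realType) (n : nat) (S : {set 'I_n}) (x : cube n) :
  chi R S x = (-1) ^+ parity S x.
Proof.
rewrite /chi /parity; elim/big_rec2: _ => [|i b c _ ->]; first by rewrite expr0.
by rewrite signr_addb.
Qed.

Definition log2 (R : realType) (x : R) : R := ln x / ln 2.

Definition fourier (R : realType) (n : nat) (g : cube n -> R)
    (S : {set 'I_n}) : R :=
  (\sum_(x : cube n) g x * chi R S x) / 2 ^+ n.

Lemma fourier_inversion (R : realType) (n : nat) (g : cube n -> R)
    (x : cube n) :
  g x = \sum_(S : {set 'I_n}) fourier g S * chi R S x.
Proof.
have sum_chi (y : cube n) :
    \sum_(S : {set 'I_n}) chi R S y * chi R S x = 2 ^+ n * (y == x)%:R.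
  transitivity (\prod_(i < n) ((-1) ^+ y i * (-1) ^+ x i + 1 : R)).
    rewrite bigA_distr; apply: eq_bigr => S _.
    by rewrite /chi -big_split /= big_mkcond.
  have [->|] := eqVneq y x.
    rewrite mulr1 (eq_bigr (fun=> 2)) => [|i _].
      by rewrite prodr_const card_ord.
    by rewrite -signr_addb addbb expr0.
  rewrite mulr0 => nyx; have [i nyxi] : exists i, y i != x i.
    apply/existsP; rewrite -negb_forall; apply: contra nyx => /forallP e.
    by apply/eqP/ffunP => i; apply/eqP.
  rewrite (bigD1 i) //= -signr_addb.
  have -> : y i (+) x i by move: nyxi; case: (y i); case: (x i).
  by rewrite expr1 addNr mul0r.
under eq_bigr => S _ do rewrite /fourier mulrAC mulr_suml mulr_suml.
rewrite exchange_big (bigD1 x) //= [X in _ + X]big1 => [|y nyx].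
  under eq_bigr => S _ do rewrite -!mulrA.
  under eq_bigr => S _ do rewrite mulrA mulrA -(mulrA (g x)).
  by rewrite -mulr_suml -mulr_sumr sum_chi eqxx mulr1 addr0 mulfK// expf_neq0.
under eq_bigr => S _ do rewrite -(mulrA (g y)).
by rewrite -mulr_suml -mulr_sumr sum_chi (negbTE nyx) !mulr0 mul0r.
Qed.

(* The minima below that are taken over sets of reals are written as infima;
   [min_entropy_attained] and [approx_spectral_norm_attained] show that these
   infima are minima. *)
Definition min_entropy (R : realType) (n : nat) (g : cube n -> R) : R :=
  inf [set log2 (1 / fourier g S ^+ 2) | S in [set S | fourier g S != 0]].

Lemma min_entropy_attained (R : realType) (n : nat) (f : cube n -> bool) :
  (exists2 S, fourier (pm R f) S != 0 &
     min_entropy (pm R f) = log2 (1 / fourier (pm R f) S ^+ 2)) /\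
  (forall S, fourier (pm R f) S != 0 ->
     min_entropy (pm R f) <= log2 (1 / fourier (pm R f) S ^+ 2)).
Proof.
set g := pm R f; pose h S := log2 (1 / fourier g S ^+ 2).
have [S0 S0P] : exists S, fourier g S != 0.
  apply/existsP; rewrite -negb_forall; apply/negP => /forallP g0.
  have := fourier_inversion g [ffun=> false].
  rewrite big1 => [|S _]; last by rewrite (eqP (g0 S)) mul0r.
  by move/eqP; rewrite /g /pm signr_eq0.
case: (@arg_minP _ _ _ S0 (fun S => fourier g S != 0) h S0P) => S SP Smin.
suff -> : min_entropy g = h S by split; first by exists S.
apply/eqP; rewrite eq_le; apply/andP; split.
  apply: ge_inf; last by exists S.
  by exists (h S) => _ [T /= TP <-]; apply: Smin.
by apply: lb_le_inf; [exists (h S), S | move=> _ [T /= TP <-]; apply: Smin].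
Qed.

Definition spectral_norm (R : realType) (n : nat) (p : cube n -> R) : R :=
  \sum_(S : {set 'I_n}) `|fourier p S|.

Definition approx_spectral_norm (R : realType) (n : nat) (f : cube n -> bool)
    (eps : R) : R :=
  inf [set spectral_norm p | p in
        [set p : cube n -> R | forall x, `|p x - pm R f x| <= eps]].

Lemma approx_spectral_norm_attained (R : realType) (n : nat)
    (f : cube n -> bool) (eps : R) : 0 <= eps ->
  (exists2 p : cube n -> R, forall x, `|p x - pm R f x| <= eps &
     approx_spectral_norm f eps = spectral_norm p) /\
  (forall p : cube n -> R, (forall x, `|p x - pm R f x| <= eps) ->
     approx_spectral_norm f eps <= spectral_norm p).
Proof.
move=> eps0; pose N := #|cube n|.
pose ev (v : 'rV[R]_N) : cube n -> R := fun x => v ord0 (enum_rank x).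
pose A (i : 'I_N) : set R :=
  `[pm R f (enum_val i) - eps, pm R f (enum_val i) + eps]%classic.
pose K : set 'rV[R]_N := [set v | forall i, A i (v ord0 i)].
have KP v : K v <-> forall x, `|ev v x - pm R f x| <= eps.
  split=> [Kv x|Kv i].
    by have := Kv (enum_rank x); rewrite /A /= in_itv /= enum_rankK -ler_distl.
  have := Kv (enum_val i).
  by rewrite /A /= in_itv /= /ev enum_valK -ler_distl.
have cK : compact K by apply: rV_compact => i; exact: segment_compact.
have K0 : K !=set0.
  exists (\row_i pm R f (enum_val i)); apply/KP => x.
  by rewrite /ev mxE enum_rankK subrr normr0.
have csum (I : finType) (F : I -> 'rV[R]_N -> R) :
    (forall i, continuous (F i)) -> continuous (fun v => \sum_i F i v).
  move=> cF; elim: (index_enum I) => [|i s IHs] v.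
    under eq_fun do rewrite big_nil.
    exact: cst_continuous.
  under eq_fun do rewrite big_cons.
  by apply: continuousD; [exact: cF | exact: IHs].
have cF : continuous (fun v => spectral_norm (ev v)).
  apply: (csum _ (fun S v => `|fourier (ev v) S|)) => S v.
  apply: (@cvg_norm _ _ _ (nbhs v) _ (fun v => fourier (ev v) S)).
  apply: cvgMr_tmp; apply: (csum _ (fun x v => ev v x * chi R S x)) => x {}v.
  by apply: cvgMr_tmp; [exact: nbhs_filter | exact: coord_continuous].
have [v vK vmin] := compact_EVT_min K0 cK (continuous_subspaceT cF).
have Kv := vK; rewrite inE in Kv.
have pmin (p : cube n -> R) : (forall x, `|p x - pm R f x| <= eps) ->
    spectral_norm (ev v) <= spectral_norm p.
  move=> pf; have evp : ev (\row_i p (enum_val i)) = p.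
    by apply/funext => x; rewrite /ev mxE enum_rankK.
  by rewrite -evp; apply: vmin; rewrite inE; apply/KP; rewrite evp.
suff -> : approx_spectral_norm f eps = spectral_norm (ev v).
  by split=> //; exists (ev v) => //; apply/KP.
apply/eqP; rewrite eq_le; apply/andP; split.
  apply: ge_inf; last by exists (ev v) => //; apply/KP.
  by exists (spectral_norm (ev v)) => _ [p /= pf <-]; apply: pmin.
apply: lb_le_inf; first by exists (spectral_norm (ev v)), (ev v) => //; apply/KP.
by move=> _ [p /= pf <-]; apply: pmin.
Qed.

Lemma ex_asbool (P : nat -> Prop) : (exists k, P k) -> exists k, `[< P k >].
Proof. by case=> k Pk; exists k; apply/asboolP. Qed.

Definition min_nat (P : nat -> Prop) (exP : exists k, P k) : nat :=
  ex_minn (ex_asbool exP).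

Lemma min_natP (P : nat -> Prop) (exP : exists k, P k) :
  P (min_nat exP) /\ forall k, P k -> (min_nat exP <= k)%N.
Proof.
rewrite /min_nat; case: ex_minnP => m /asboolP Pm mmin; split=> // k Pk.
by apply: mmin; apply/asboolP.
Qed.

Definition indicator_mx (n k : nat) (S : 'I_k -> {set 'I_n}) : 'M['F_2]_(k, n) :=
  \matrix_(j < k, i < n) (i \in S j)%:R.

Definition affine_subspace (n k : nat) (V : {set cube n}) : Prop :=
  exists (S : 'I_k -> {set 'I_n}) (b : 'I_k -> bool),
    row_free (indicator_mx S) /\
    forall x : cube n, (x \in V) = [forall j, parity (S j) x == b j].

Definition constant_on_codim (n : nat) (f : cube n -> bool) (k : nat) : Prop :=
  exists V : {set cube n},
    affine_subspace k V /\ exists c : bool, forall x, x \in V -> f x = c.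

Lemma ex_constant_on_codim (n : nat) (f : cube n -> bool) :
  exists k, constant_on_codim f k.
Proof.
pose z : cube n := [ffun=> false]; exists n, [set z]%SET; split; last first.
  by exists (f z) => x /set1P ->.
exists (fun j => [set j]%SET), (fun=> false); split.
  rewrite (_ : indicator_mx _ = 1%:M) ?row_free_unit ?unitmx1 //.
  by apply/matrixP => i j; rewrite !mxE finset.in_set1 eq_sym.
move=> x; rewrite finset.in_set1; apply/eqP/forallP => [-> j|xz].
  by rewrite /parity big_set1 ffunE.
by apply/ffunP => j; have := xz j; rewrite /parity big_set1 ffunE => /eqP.
Qed.

Definition min_parity_certificate (n : nat) (f : cube n -> bool) : nat :=
  min_nat (ex_constant_on_codim f).

(* In [PNode A t0 t1], the computation goes to [t0] when the product of the
   x_i for i in A is 1, and to [t1] when it is -1. *)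
Inductive pdt (n : nat) : Type :=
| PLeaf of bool
| PNode of {set 'I_n} & pdt n & pdt n.

Arguments PLeaf {n} b.

Fixpoint pdt_depth (n : nat) (t : pdt n) : nat :=
  match t with
  | PLeaf _ => 0
  | PNode _ t0 t1 => (maxn (pdt_depth t0) (pdt_depth t1)).+1
  end.

Fixpoint pdt_eval (n : nat) (t : pdt n) (x : cube n) : bool :=
  match t with
  | PLeaf b => b
  | PNode A t0 t1 => if parity A x then pdt_eval t1 x else pdt_eval t0 x
  end.

HB.instance Definition _ (n : nat) := gen_eqMixin (pdt n).
HB.instance Definition _ (n : nat) := gen_choiceMixin (pdt n).
HB.instance Definition _ (n : nat) := isPointed.Build (pdt n) (PLeaf false).
(* There are countably many trees, so that the probability measures for the
   discrete sigma-algebra are exactly the probability distributions on trees. *)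
HB.instance Definition _ (n : nat) :=
  @isMeasurable.Build default_measure_display (pdt n) discrete_measurable
    discrete_measurable0 discrete_measurableC discrete_measurableU.

Definition has_complexity (R : realType) (n : nat)
    (mu : probability (pdt n) R) (d : nat) : Prop :=
  (exists2 t, mu [set t] != 0%E & pdt_depth t = d) /\
  (forall t, mu [set t] != 0%E -> (pdt_depth t <= d)%N).

Definition computes_bounded_error (R : realType) (n : nat)
    (mu : probability (pdt n) R) (f : cube n -> bool) : Prop :=
  forall x, ((2 / 3 : R)%:E <= mu [set t | pdt_eval t x = f x])%E.

Definition rpdt_complexity (R : realType) (n : nat) (f : cube n -> bool)
    (d : nat) : Prop :=
  exists mu : probability (pdt n) R,
    has_complexity mu d /\ computes_bounded_error mu f.

Lemma ex_rpdt_complexity (R : realType) (n : nat) (f : cube n -> bool) :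
  exists d, rpdt_complexity R f d.
Proof.
have build (s : seq 'I_n) (y : cube n) : exists t : pdt n, forall x : cube n,
    (forall i, i \notin s -> x i = y i) -> pdt_eval t x = f x.
  elim: s y => [|i s IHs] y.
    exists (PLeaf (f y)) => x xy /=; congr f.
    by apply/ffunP => i; rewrite xy.
  pose upd b : cube n := [ffun j => if j == i then b else y j].
  have [t0 t0P] := IHs (upd false); have [t1 t1P] := IHs (upd true).
  exists (PNode [set i]%SET t0 t1) => x xy /=.
  rewrite /parity big_set1.
  by case: ifP => xi; [apply: t1P | apply: t0P] => j js; rewrite ffunE;
    have [->|ji] := eqVneq j i => //; apply: xy;
    rewrite inE negb_or ji.
have [t tP] := build (enum 'I_n) [ffun=> false].
have {}tP x : pdt_eval t x = f x by apply: tP => i; rewrite mem_enum.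
exists (pdt_depth t), (\d_t : probability (pdt n) R); split; first split.
- by exists t => //=; rewrite diracE mem_set//= oner_eq0.
- move=> u /=; rewrite diracE; case: (boolP (t \in [set u])) => [|_].
    by rewrite inE /= => ->.
  by rewrite eqxx.
- move=> x /=; rewrite diracE mem_set //= lee_fin ler_pdivrMr// mul1r.
  by rewrite ler_nat.
Qed.

Definition bounded_error_rpdt (R : realType) (n : nat) (f : cube n -> bool)
    : nat :=
  min_nat (ex_rpdt_complexity R f).

(* Main.v *)
(* Let M be the largest |hat f(S)|, so that the min-entropy is 2 log2 (1 / M);
   every part is a lower bound on M.
   (i) If p is within eps of f, then E[p f] >= 1 - eps, while Plancherel gives
   E[p f] <= M * spectral_norm p.
   (ii) The indicator of a half-cube has spectral norm at most 1, so multiplying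
   by one does not increase the largest Fourier coefficient; on an affine
   subspace of co-dimension k where f is constant, |E[f 1_V]| = 2^-k.
   (iii) By the same remark a tree of depth d has correlation at most 2^d M
   with f, whereas by averaging over the inputs some tree in the support
   agrees with f on 2/3 of them, so 1/3 <= 2^d M.  This suffices when
   d >= 1; when d = 0, f is constant. *)
Require Import Defs.
From mathcomp Require Import all_boot all_order all_algebra.
From mathcomp Require Import all_classical all_reals all_analysis.
From mathcomp Require Import ring lra.

Set Implicit Arguments.
Unset Strict Implicit.
Unset Printing Implicit Defensive.

Import Order.TTheory GRing.Theory Num.Theory.

Local Open Scope ring_scope.

Section MinEntropy.
Variables (R : realType) (n : nat).
Implicit Types (f : cube n -> bool) (g h : cube n -> R) (S A : {set 'I_n}).
Implicit Types (x y : cube n) (M c : R).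

(** * Base-2 logarithms and the reduction to the largest coefficient *)

Lemma log2M : {in Num.pos &, {morph @log2 R : x y / x * y >-> x + y}}.
Proof. by move=> x y x0 y0; rewrite /log2 lnM// mulrDl. Qed.

Lemma ln2_gt0 : 0 < ln 2 :> R.
Proof. by rewrite ln_gt0 ?ltr1n. Qed.

Lemma log2_expr2 k : log2 (2 ^+ k) = k%:R :> R.
Proof. by rewrite /log2 lnXn// -[ln 2 *+ k]mulr_natl mulfK// gt_eqF// ln2_gt0. Qed.

Lemma ler_log2 : {in Num.pos &, {mono @log2 R : x y / x <= y}}.
Proof. by move=> x y x0 y0; rewrite /log2 ler_pM2r ?invr_gt0 ?ln2_gt0// ler_ln. Qed.

Lemma ex_fourier_pm_neq0 f : exists S, fourier (pm R f) S != 0.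
Proof. by have [[S S0 _] _] := min_entropy_attained R f; exists S. Qed.

(** Taking [M] to be the largest absolute coefficient turns the hypothesis into a lower bound on an
    attained coefficient, whose logarithm bounds the minimum. *)
Lemma min_entropy_le f c : 0 < c ->
  (forall M, (forall S, `|fourier (pm R f) S| <= M) -> c <= M) ->
  min_entropy (pm R f) <= 2 * log2 c^-1.
Proof.
move=> c0 cM; have [S0 S0P] := ex_fourier_pm_neq0 f.
case: (@arg_maxP _ _ _ S0 xpredT (fun S => `|fourier (pm R f) S|)) => // S _ Smax.
have cS : c <= `|fourier (pm R f) S| by apply: cM => T; exact: Smax.
have F0 : 0 < `|fourier (pm R f) S| by exact: lt_le_trans cS.
have [_ /(_ S)] := min_entropy_attained R f.
rewrite -normr_gt0 => /(_ F0) /le_trans; apply.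
rewrite [leRHS](_ : _ = log2 (c^-1 ^+ 2)); last first.
  by rewrite expr2 log2M ?posrE ?invr_gt0// mulr_natl mulr2n.
rewrite ler_log2 ?posrE ?exprn_gt0 ?invr_gt0//; last first.
  by rewrite divr_gt0// -real_normK ?num_real// exprn_gt0.
rewrite div1r -(real_normK (num_real _)) exprVn lef_pV2 ?posrE ?exprn_gt0//.
by rewrite ler_pXn2r ?nnegrE ?(ltW c0) ?(ltW F0).
Qed.

(** * Plancherel and the spectral norm *)

Lemma natr_card_cube : #|cube n|%:R = 2 ^+ n :> R.
Proof. by rewrite card_ffun card_bool card_ord natrX. Qed.

Lemma sum_mul_fourier g h :
  \sum_x g x * h x = 2 ^+ n * \sum_S fourier g S * fourier h S.
Proof.
transitivity (\sum_x \sum_S g x * (fourier h S * chi R S x)).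
  by apply: eq_bigr => x _; rewrite {1}(fourier_inversion h) mulr_sumr.
rewrite exchange_big mulr_sumr; apply: eq_bigr => S _ /=.
under eq_bigr do rewrite mulrCA.
rewrite -mulr_sumr {2}/fourier; field; exact: expf_neq0.
Qed.

Lemma spectral_norm_lower_bound f (eps : R) (p : cube n -> R) M :
  (forall S, `|fourier (pm R f) S| <= M) ->
  (forall x, `|p x - pm R f x| <= eps) -> 1 - eps <= M * spectral_norm p.
Proof.
move=> fM pf; have N0 : 0 < 2 ^+ n :> R by rewrite exprn_gt0.
rewrite -(ler_pM2l N0).
apply: (@le_trans _ _ (\sum_x pm R f x * p x)); last first.
  rewrite sum_mul_fourier ler_pM2l// /spectral_norm mulr_sumr ler_sum// => S _.
  by rewrite (le_trans (ler_norm _))// normrM ler_wpM2r.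
(* Pointwise, [f * p = 1 + f * (p - f)] because [f] is a sign. *)
apply: (@le_trans _ _ (\sum_(x : cube n) (1 - eps))).
  by rewrite -natr_card_cube mulr_natl sumr_const.
apply: ler_sum => x _; move: (pf x); rewrite ler_norml /pm.
by case: (f x); rewrite ?expr1 ?expr0; lra.
Qed.

(** * Half-cubes and parity-decision trees *)

Lemma parity_symdiff S A x :
  parity ((S :\: A) :|: (A :\: S)) x = parity S x (+) parity A x.
Proof.
rewrite /parity !(big_mkcond (fun i => i \in _)) -big_split /=.
apply: eq_bigr => i _; rewrite !inE.
by case: (i \in S); case: (i \in A); case: (x i).
Qed.

Lemma fourier_mul_chi g A S :
  fourier (fun x => g x * chi R A x) S = fourier g ((A :\: S) :|: (S :\: A)).
Proof.
rewrite /fourier; congr (_ / _); apply: eq_bigr => x _.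
by rewrite -mulrA !chi_parity -signr_addb parity_symdiff.
Qed.

(** The indicator is [(1 + (-1) ^+ b * chi R A) / 2], and multiplying by [chi R A] only permutes
    coefficients, so each new coefficient is, up to sign, an average of two old ones. *)
Lemma fourier_half_bound h A (b : bool) M :
  (forall S, `|fourier h S| <= M) -> forall S,
  `|fourier (fun x => h x * (parity A x == b)%:R) S| <= M.
Proof.
move=> hM S.
have -> : fourier (fun x => h x * (parity A x == b)%:R) S =
    (fourier h S + (-1) ^+ b * fourier (fun x => h x * chi R A x) S) / 2.
  rewrite /fourier [_ * (_ / _)]mulrA -mulrDl mulr_sumr -big_split /=.
  rewrite [RHS]mulrAC; congr (_ / _); rewrite mulr_suml.
  apply: eq_bigr => x _; rewrite (chi_parity R A).
  by case: (parity A x); case: b; rewrite /= ?expr1 ?expr0; field.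
rewrite fourier_mul_chi normrM normfV normr_nat ler_pdivrMr//.
rewrite (le_trans (ler_normD _ _))// normrMsign.
by rewrite mulr_natr mulr2n lerD.
Qed.

(** The root query splits [h] into its restrictions to two half-cubes, both still bounded by [M];
    hence one doubling per level, with [h] general in the induction. *)
Lemma fourier_pdt_bound (t : pdt n) h M :
  (forall S, `|fourier h S| <= M) -> forall S,
  `|fourier (fun x => h x * pm R (pdt_eval t) x) S| <= 2 ^+ pdt_depth t * M.
Proof.
elim: t h => [b|A t0 IH0 t1 IH1] h hM S /=.
  rewrite expr0 mul1r.
  rewrite [fourier _ _](_ : _ = (-1) ^+ b * fourier h S).
    by rewrite normrMsign.
  rewrite /fourier mulrA mulr_sumr; congr (_ / _); apply: eq_bigr => x _.
  by rewrite /pm /= mulrCA mulrA.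
have M0 : 0 <= M by apply: le_trans (hM S).
rewrite [fourier _ _](_ : _ =
    fourier (fun x => (h x * (parity A x == false)%:R) * pm R (pdt_eval t0) x) S
  + fourier (fun x => (h x * (parity A x == true)%:R) * pm R (pdt_eval t1) x) S).
  rewrite (le_trans (ler_normD _ _))// exprS -mulrA [2 * _]mulr_natl mulr2n.
  apply: lerD; [apply: le_trans (IH0 _ _ _) _ | apply: le_trans (IH1 _ _ _) _];
    try exact: fourier_half_bound.
    by rewrite ler_wpM2r// ler_weXn2l ?ler1n// leq_maxl.
  by rewrite ler_wpM2r// ler_weXn2l ?ler1n// leq_maxr.
rewrite /fourier -mulrDl -big_split /=; congr (_ / _); apply: eq_bigr => x _.
by rewrite /pm /=; case: (parity A x); rewrite /=; ring.
Qed.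

(** * Affine subspaces *)

Definition cube_add x y : cube n := [ffun i => x i (+) y i].

Lemma cube_addK y : involutive (cube_add^~ y).
Proof. by move=> x; apply/ffunP => i; rewrite !ffunE addbK. Qed.

Lemma parity_cube_add S x y :
  parity S (cube_add x y) = parity S x (+) parity S y.
Proof. by rewrite /parity -big_split; apply: eq_bigr => i _; rewrite ffunE. Qed.

Lemma natr_parity_F2 S x :
  (parity S x)%:R = \sum_(i in S) (x i)%:R :> 'F_2.
Proof.
rewrite /parity; apply: (big_morph (fun b : bool => b%:R : 'F_2)) => //.
by case; case; apply/val_inj.
Qed.

Lemma F2_natr (a : 'F_2) : a = (a != 0)%:R.
Proof. by case: a => [[|[|[]]]] //= i; apply/val_inj. Qed.

(** Column [j] of a right inverse of the indicator matrix, read as a point of the cube. *)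
Lemma row_free_dual k (S : 'I_k -> {set 'I_n}) (j : 'I_k) :
  row_free (indicator_mx S) -> exists y, forall i, parity (S i) y = (i == j).
Proof.
move=> /row_freeP [B SB]; exists [ffun i => B i j != 0] => i.
have : (parity (S i) [ffun l => B l j != 0])%:R = (i == j)%:R :> 'F_2.
  rewrite natr_parity_F2; have /matrixP/(_ i j) := SB; rewrite !mxE => <-.
  rewrite big_mkcond; apply: eq_bigr => l _; rewrite mxE ffunE -F2_natr.
  by case: (l \in S i); rewrite ?mul1r ?mul0r.
by case: (parity _ _); case: (i == j).
Qed.

(** Expanding each indicator as [(1 + sign) / 2] gives one term per set [T] of constraints. The
    empty [T] yields the value; the others vanish when summed over [x], by independence. *)
Lemma sum_affine_subspace k (S : 'I_k -> {set 'I_n}) (b : 'I_k -> bool) :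
  row_free (indicator_mx S) ->
  \sum_x \prod_j (parity (S j) x == b j)%:R = 2 ^+ n / 2 ^+ k :> R.
Proof.
move=> rfS.
transitivity (\sum_x (\sum_(T : {set 'I_k})
    \prod_(j in T) (-1) ^+ (b j (+) parity (S j) x)) / 2 ^+ k : R).
  apply: eq_bigr => x _.
  rewrite -[k in 2 ^+ k]card_ord -prodr_const -[RHS]/(_ * _) -prodfV.
  have -> : \sum_(T : {set 'I_k}) \prod_(j in T) (-1) ^+ (b j (+) parity (S j) x)
      = \prod_j ((-1) ^+ (b j (+) parity (S j) x) + 1 : R).
    rewrite bigA_distr; apply: eq_bigr => T _.
    by rewrite big_mkcond.
  rewrite -big_split /=; apply: eq_bigr => j _.
  by case: (b j); case: (parity _ _); rewrite /= ?expr1 ?expr0; field.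
rewrite -mulr_suml; congr (_ / _); rewrite exchange_big /=.
rewrite (bigD1 finset.set0) //= [X in _ + X]big1 ?addr0.
  under eq_bigr do rewrite big_set0.
  by rewrite -natr_card_cube sumr_const.
move=> T /set0Pn[j jT]; have [y yP] := row_free_dual j rfS.
(* Translating by [y] flips exactly one factor of the product. *)
apply/eqP; rewrite -eqNr; apply/eqP.
rewrite [RHS](reindex_inj (inv_inj (cube_addK y))) -sumrN.
apply: eq_bigr => x _; rewrite (bigD1 j jT) [RHS](bigD1 j jT) /=.
rewrite parity_cube_add yP eqxx -mulNr; congr (_ * _).
  by case: (b j); case: (parity _ _); rewrite /= ?expr1 ?expr0 ?opprK.
by apply: eq_bigr => i /andP[_ ij]; rewrite parity_cube_add yP (negbTE ij) addbF.
Qed.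

Lemma fourier_affine_subspace_bound k (S : 'I_k -> {set 'I_n}) (b : 'I_k -> bool)
    h M : (forall A, `|fourier h A| <= M) ->
  forall A, `|fourier (fun x => h x * \prod_j (parity (S j) x == b j)%:R) A| <= M.
Proof.
(* With the enumeration generalised to any list, each constraint contributes one half-cube
   factor. *)
move=> hM; elim: (index_enum _) => [|j s IHs] A.
  under [X in fourier X]funext do rewrite big_nil mulr1.
  exact: hM.
have -> : (fun x => h x * \prod_(j <- j :: s) (parity (S j) x == b j)%:R) =
    (fun x => h x * \prod_(j <- s) (parity (S j) x == b j)%:R *
      (parity (S j) x == b j)%:R).
  by apply/funext => x; rewrite big_cons mulrCA mulrC.
exact: fourier_half_bound.
Qed.

Lemma constant_on_codim_bound f k M : constant_on_codim f k ->
  (forall S, `|fourier (pm R f) S| <= M) -> (2 ^+ k)^-1 <= M.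
Proof.
move=> [V [[S [b [rfS VP]]] [c fc]]] fM.
(* The coefficient at the empty set is the mean, here the constant sign times the density of [V]. *)
have := fourier_affine_subspace_bound S b fM finset.set0.
rewrite [fourier _ _](_ : _ = (-1) ^+ c * (2 ^+ k)^-1).
  by rewrite normrMsign ger0_norm// invr_ge0 exprn_ge0.
have N0 : 2 ^+ n != 0 :> R by exact: expf_neq0.
rewrite -[(2 ^+ k)^-1](mulKf N0) -(sum_affine_subspace b rfS) mulrCA mulrC.
rewrite /fourier mulr_sumr; congr (_ / _); apply: eq_bigr => x _.
rewrite chi_parity /parity big_set0 expr0 mulr1.
have [/(fc x)|] := boolP (x \in V); first by rewrite /pm => ->.
rewrite VP negb_forall => /existsP [j /negbTE xj].
by rewrite (bigD1 j)//= xj mul0r !mulr0.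
Qed.

(** * Distributions on trees *)

Fixpoint pdt_code (t : pdt n) : GenTree.tree (bool + {set 'I_n}) :=
  match t with
  | PLeaf b => GenTree.Leaf (inl b)
  | PNode A t0 t1 =>
      GenTree.Node 0 [:: GenTree.Leaf (inr A); pdt_code t0; pdt_code t1]
  end.

Lemma pdt_code_inj : injective pdt_code.
Proof.
elim=> [b|A t0 IH0 t1 IH1] [c|B u0 u1] //= []; first by move=> ->.
by move=> -> /IH0-> /IH1->.
Qed.

(** The trees violating [P] are sorted by their integer codes into countably many classes, each
    empty or a single tree of mass zero. *)
Lemma ae_pdt (mu : probability (pdt n) R) (P : pdt n -> Prop) :
  (forall t, mu [set t]%classic != 0%E -> P t) -> {ae mu, forall t, P t}.
Proof.
move=> muP; pose F k : set (pdt n) :=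
  [set t | ~ P t /\ pickle (pdt_code t) = k]%classic.
apply: (@negligibleS _ _ _ _ (\bigcup_k F k)%classic).
  by move=> t Pt; exists (pickle (pdt_code t)).
apply: negligible_bigcup => k.
have [->|/set0P[t [nPt tk]]] := eqVneq (F k) classical_sets.set0.
  exact: negligible_set0.
exists [set t]%classic; split=> //.
  by apply/eqP; apply: contrapT => /negP/muP.
move=> u [_]; rewrite -tk => /(pcan_inj pickleK) /pdt_code_inj.
by move=> ->.
Qed.

(* The easy direction of Yao's minimax principle, for the uniform distribution
   on the family [x]. *)
Lemma computes_bounded_error_count (mu : probability (pdt n) R) f
    (I : finType) (x : I -> cube n) c :
  computes_bounded_error mu f ->
  (forall t, mu [set t]%classic != 0%E ->
     \sum_i (pdt_eval t (x i) == f (x i))%:R <= c) ->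
  2 / 3 * #|I|%:R <= c.
Proof.
move=> muf muc.
(* Some tree has positive mass, since the total mass is 1; this gives [0 <= c], used when comparing
   integrals. *)
have [t0 t0P] : exists t, mu [set t]%classic != 0%E.
  apply: contrapT => noT; have [N [_ N0 NP]] : {ae mu, forall t, False}.
    by apply: ae_pdt => t tP; apply: noT; exists t.
  have : (mu [set: pdt n]%classic <= mu N)%E.
    by rewrite le_measure ?inE// => ? _; apply: NP.
  by rewrite probability_setT N0 lee_fin ler10.
have c0 : 0 <= c by apply: le_trans (muc _ t0P); apply: sumr_ge0.
pose A i : set (pdt n) := [set t | pdt_eval t (x i) = f (x i)]%classic.
rewrite -lee_fin.
apply: (@le_trans _ _ (\sum_i mu (A i))%E).
  apply: (@le_trans _ _ (\sum_(i : I) (2 / 3 : R)%:E)%E); last first.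
    by apply: lee_sum => i _; exact: muf.
  by rewrite sumEFin sumr_const mulr_natr.
(* The success probabilities add up to the expected number of agreements. *)
have -> : (\sum_i mu (A i) = \int[mu]_t \sum_i (\1_(A i) t)%:E)%E.
  rewrite ge0_integral_sum//.
  by apply: eq_bigr => i _; rewrite integral_indic// setIT.
rewrite -[leRHS]mule1 -(probability_setT mu) -integral_cst//.
apply: ae_ge0_le_integral => //.
- by move=> t _; apply: sume_ge0 => i _; rewrite lee_fin.
- apply: filterS (ae_pdt muc) => t tc _; rewrite sumEFin lee_fin.
  apply: le_trans tc; apply: ler_sum => i _; rewrite indicE.
  by case: eqP => ti; [rewrite mem_set | rewrite memNset].
Qed.

Lemma rpdt_complexity_bound f d M : rpdt_complexity R f d ->
  (forall S, `|fourier (pm R f) S| <= M) -> (2 ^+ d)^-1 / 3 <= M.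
Proof.
move=> [mu [[_ mud] muf]] fM.
have M0 : 0 <= M by apply: le_trans (fM finset.set0).
have N0 : 0 < 2 ^+ n :> R by rewrite exprn_gt0.
have d0 : 0 < 2 ^+ d :> R by rewrite exprn_gt0.
(* Correlation at most [2 ^+ d * M] means agreement on at most a fraction [(1 + 2 ^+ d * M) / 2] of
   the inputs. *)
have := @computes_bounded_error_count mu f (cube n) id
  (2 ^+ n * (1 + 2 ^+ d * M) / 2) muf.
rewrite natr_card_cube -[_ / 2]mulrA [2 / 3 * _]mulrC ler_pM2l// => H.
suff : 2 / 3 <= (1 + 2 ^+ d * M) / 2.
  by move=> ?; rewrite ler_pdivrMr// -[_^-1]mulr1 ler_pdivrMl// mulrA; lra.
apply: H => t /mud td; rewrite mulrC -ler_pdivrMr//.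
have agree : \sum_x pm R f x * pm R (pdt_eval t) x * chi R finset.set0 x =
    2 * (\sum_x (pdt_eval t x == f x)%:R) - 2 ^+ n.
  rewrite -natr_card_cube -sum1_card natr_sum mulr_sumr -sumrB.
  apply: eq_bigr => x _; rewrite chi_parity /parity big_set0 /pm.
  by case: (f x); case: (pdt_eval t x); rewrite /= ?expr1 ?expr0; ring.
have := fourier_pdt_bound t fM finset.set0.
rewrite /fourier agree mulrBl divff ?gt_eqF// => /ler_normlW tM.
have : 2 ^+ pdt_depth t * M <= 2 ^+ d * M.
  by rewrite ler_wpM2r// ler_weXn2l ?ler1n.
lra.
Qed.

(** If [f x] and [f y] differ, a leaf is right on exactly one of the two points, whereas the average
    number of agreements must be at least 4/3. *)
Lemma rpdt_complexity0 f : rpdt_complexity R f 0 -> forall x y, f x = f y.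
Proof.
move=> [mu [[_ mu0] muf]] x y; apply/eqP/negPn/negP => fxy.
have := @computes_bounded_error_count mu f bool (fun b => if b then x else y) 1 muf.
rewrite card_bool => H; suff : 2 / 3 * 2 <= 1 :> R by lra.
apply: H => t /mu0; rewrite leqn0 big_bool; case: t => //= b _.
by move: fxy; case: (f x); case: (f y); case: b; rewrite //= ?addr0 ?add0r.
Qed.

Lemma constant_on_codim0 f : (forall x y, f x = f y) -> constant_on_codim f 0.
Proof.
move=> fc; exists [set: cube n]%SET; split; last first.
  by exists (f [ffun=> false]) => x _; apply: fc.
exists (fun=> finset.set0), (fun=> false); split.
  by rewrite /row_free -leqn0 rank_leq_row.
by move=> x; rewrite inE; apply/esym/forallP => -[].
Qed.

(** * Upper bounds on the min-entropy *)

Lemma min_entropy_le_codim f k :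
  constant_on_codim f k -> min_entropy (pm R f) <= 2 * k%:R.
Proof.
move=> fk; rewrite -(log2_expr2 k) -[2 ^+ k]invrK.
apply: min_entropy_le => [|M fM]; first by rewrite invr_gt0 exprn_gt0.
exact: constant_on_codim_bound fk fM.
Qed.

Lemma min_entropy_le_approx f (eps : R) : 0 <= eps -> eps < 1 ->
  min_entropy (pm R f) <= 2 * log2 (approx_spectral_norm f eps / (1 - eps)).
Proof.
move=> eps0 eps1; have [[p pf ->] _] := approx_spectral_norm_attained f eps0.
have e0 : 0 < 1 - eps by rewrite subr_gt0.
(* Were the norm zero, any uniform bound on the coefficients, such as the sum of their absolute
   values, would give [1 - eps <= 0]. *)
have P0 : 0 < spectral_norm p.
  rewrite lt0r sumr_ge0// andbT; apply/eqP => p0.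
  have [S0 _] := ex_fourier_pm_neq0 f.
  have := @spectral_norm_lower_bound f eps p
    (\sum_S `|fourier (pm R f) S|) _ pf.
  rewrite p0 mulr0 leNgt e0 => H; suff : false by [].
  by apply: H => S; rewrite (bigD1 S)//= lerDl sumr_ge0.
rewrite -invf_div; apply: min_entropy_le => [|M fM]; first by rewrite divr_gt0.
by rewrite ler_pdivrMr//; exact: spectral_norm_lower_bound fM pf.
Qed.

Lemma min_entropy_le_rpdt f d : rpdt_complexity R f d ->
  min_entropy (pm R f) <= 2 * (1 + log2 3) * d%:R.
Proof.
(* At depth 0 the correlation bound would leave [2 * log2 3] instead of 0, so co-dimension 0 is
   used. *)
case: d => [/rpdt_complexity0/constant_on_codim0/min_entropy_le_codim|d fd].
  by rewrite !mulr0.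
have l3 : 0 <= log2 3 :> R by rewrite divr_ge0// ln_ge0// ler1n.
apply: (@le_trans _ _ (2 * log2 (2 ^+ d.+1 * 3))).
  rewrite -[2 ^+ _ * 3]invrK invfM.
  apply: min_entropy_le => [|M fM].
    by rewrite divr_gt0// invr_gt0 exprn_gt0.
  exact: rpdt_complexity_bound fd fM.
rewrite log2M ?posrE ?exprn_gt0// log2_expr2 -mulrA ler_wpM2l//.
(* Since the depth is at least 1, [log2 3] is at most its multiple by the depth. *)
by rewrite mulrDl mul1r lerD2l ler_peMr// ler1n.
Qed.

End MinEntropy.

Theorem theorem1p8 (R : realType) (n : nat) (f : cube n -> bool) :
  (forall eps : R, 0 <= eps -> eps < 1 ->
     min_entropy (pm R f) <=
       2 * log2 (approx_spectral_norm f eps / (1 - eps))) /\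
  (min_entropy (pm R f) <= 2 * (min_parity_certificate f)%:R) /\
  (min_entropy (pm R f) <=
     2 * (1 + log2 3) * (bounded_error_rpdt R f)%:R).
Proof.
split; first by move=> eps; exact: min_entropy_le_approx.
split; first by apply: min_entropy_le_codim; exact: (min_natP _).1.
by apply: min_entropy_le_rpdt; exact: (min_natP _).1.
Qed.
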